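(* Let $R_0$ be either the ring $\mathbb{Z}_k$ of integers modulo $k$ ($k\ge2$) or the field $\mathbb{F}_p$ of prime order $p$. Let $C$ be a linear code of length $n$ over $R_0$, and let $G$ be a finite permutation group on the coordinates of $R_0^n$. Then $C$ is a $G$-code if and only if $\Lambda(C)$ is a $G$-lattice.
   Context: A linear code of length $n$ over $R_0$ is an $R_0$-submodule of $R_0^n$. A permutation group $G$ on the coordinate set $\{1,\dots,n\}$ acts on $R_0^n$ and on $\mathbb{R}^n$ on the right by $(vg)_i=v_{ig^{-1}}$. A $G$-code is a linear code $C\subseteq R_0^n$ with $Cg\subseteq C$ for all $g\in G$. A lattice in $\mathbb{R}^n$ is the $\mathbb{Z}$-span of an $\mathbb{R}$-basis of $\mathbb{R}^n$; a $G$-lattice is a lattice $\Lambda$ in $\mathbb{R}^n$ with $\Lambda g\subseteq\Lambda$ for all $g\in G$. Let $\rho:\mathbb{Z}^n\to R_0^n$ be coordinatewise reduction modulo $|R_0|$. Construction A: $\Lambda(C):=\frac{1}{\sqrt{|R_0|}}\{x\in\mathbb{Z}^n:\rho(x)\in C\}$. *)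

(* Defs.v *)
From mathcomp Require Import all_boot all_order all_fingroup all_algebra.
From mathcomp Require Import classical_sets reals.

Set Implicit Arguments.
Unset Strict Implicit.
Unset Printing Implicit Defensive.

Import GRing.Theory Num.Theory.

Local Open Scope ring_scope.
Local Open Scope classical_set_scope.

(* [col_perm s v] has [i]-th entry [v 0 (s i)], so this is (vg)_i = v_{ig^-1}. *)
Definition coord_act (T : Type) (n : nat) (v : 'rV[T]_n) (g : 'S_n) : 'rV[T]_n :=
  col_perm (g^-1)%g v.

Definition linear_code (R0 : finComNzRingType) (n : nat)
    (C : {set 'rV[R0]_n}) : Prop :=
  GRing.submod_closed C.

Definition G_code (R0 : finComNzRingType) (n : nat) (G : {group 'S_n})
    (C : {set 'rV[R0]_n}) : Prop :=
  linear_code C /\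
  (forall g v, g \in G -> v \in C -> coord_act v g \in C).

Definition lattice (R : realType) (n : nat) (L : set 'rV[R]_n) : Prop :=
  exists2 b : n.-tuple 'rV[R]_n, basis_of fullv b &
    L = [set v | exists z : 'I_n -> int, v = \sum_(i < n) tnth b i *~ z i].

Definition G_lattice (R : realType) (n : nat) (G : {group 'S_n})
    (L : set 'rV[R]_n) : Prop :=
  lattice L /\
  (forall g v, g \in G -> L v -> L (coord_act v g)).

(* For R0 = 'Z_k or 'F_p the unique ring morphism int -> R0 is reduction
   modulo #|R0|. *)
Definition reduction (R0 : finComNzRingType) (n : nat) (x : 'rV[int]_n) :
    'rV[R0]_n :=
  map_mx intr x.

Definition construction_A (R : realType) (R0 : finComNzRingType) (n : nat)
    (C : {set 'rV[R0]_n}) : set 'rV[R]_n :=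
  [set (Num.sqrt (#|R0|%:R : R))^-1 *: map_mx intr x
     | x in [set x : 'rV[int]_n | reduction R0 x \in C]].

Arguments construction_A R {R0 n} C.

(* Main.v *)
(** A subgroup of [Z^n] containing [q Z^n] is generated by [q Z^n] and finitely
many of its elements, so by the Smith normal form it is [Z^n B] for some integer
matrix [B] of nonzero determinant; hence [construction_A R C] is always a
lattice.  Invariance transfers between [C] and [construction_A R C] because
permuting coordinates commutes with reduction, and reduction is surjective. *)
Require Import Defs.
From HB Require Import structures.
From mathcomp Require Import all_boot all_order all_fingroup all_algebra.
From mathcomp Require Import classical_sets reals.

Set Implicit Arguments.
Unset Strict Implicit.
Unset Printing Implicit Defensive.

Import GRing.Theory Num.Theory.

Local Open Scope ring_scope.

(** Modulo [q.+1], each [x] agrees with one vector with entries in [0..q], which lies in [P] if [x]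
    does, since their difference is in [P]. Only finitely many such residue vectors exist. *)
Lemma subgroup_row_span (n q : nat) (P : zmodClosed 'rV[int]_n) :
    (forall x : 'rV[int]_n, q.+1%:Z *: x \in P) ->
  exists m (A : 'M[int]_(m, n)),
    forall x, x \in P <-> exists y, x = y *m col_mx q.+1%:Z%:M A.
Proof.
move=> qP; pose lift (u : 'rV['I_q.+1]_n) : 'rV[int]_n :=
  map_mx (fun i : 'I_q.+1 => i%:Z) u.
(* All residue vectors index the rows; those outside [P] give a zero row, which keeps the row span
   inside [P]. *)
pose A := \matrix_(i < #|{: 'rV['I_q.+1]_n}|)
  (if lift (enum_val i) \in P then lift (enum_val i) else 0).
exists #|{: 'rV['I_q.+1]_n}|, A => x; split=> [Px | [y ->]]; last first.
  rewrite -[y]hsubmxK mul_row_col mul_mx_scalar rpredD // mulmx_sum_row.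
  apply: rpred_sum => i _; rewrite rowK -[rsubmx y 0 i]intz scaler_int rpredMz //.
  by case: ifP => // _; exact: rpred0.
pose u : 'rV['I_q.+1]_n := \row_j inord `|(x 0%R j %% q.+1%:Z)%Z|%N.
pose z : 'rV[int]_n := \row_j (x 0%R j %/ q.+1%:Z)%Z.
have def_x : x = q.+1%:Z *: z + lift u.
  apply/rowP => j; rewrite !mxE inordK; last first.
    by rewrite -ltz_nat gez0_abs ?modz_ge0 ?ltz_pmod.
  by rewrite gez0_abs ?modz_ge0 // mulrC -divz_eq.
have Pu : lift u \in P.
  have -> : lift u = x - q.+1%:Z *: z by rewrite def_x addrC addKr.
  exact: rpredB.
(* The quotients [z] multiply the scalar block; the unit vector selects the row of [A] that holds
   [lift u]. *)
exists (row_mx z (delta_mx 0 (enum_rank u))).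
by rewrite mul_row_col mul_mx_scalar -rowE rowK enum_rankK Pu {1}def_x.
Qed.

Lemma subgroup_basis (n q : nat) (P : zmodClosed 'rV[int]_n) :
    (forall x : 'rV[int]_n, q.+1%:Z *: x \in P) ->
  exists2 B : 'M[int]_n, \det B != 0 &
    forall x, x \in P <-> exists y, x = y *m B.
Proof.
move=> qP; have [m [A PA]] := subgroup_row_span qP.
have [L uL [U uU [d _ defM]]] := int_Smith_normal_form (col_mx q.+1%:Z%:M A).
pose D : 'M[int]_n := \matrix_(i, j) (d`_i *+ (i == j :> nat)).
(* The last [m] rows have index at least [n], so they never meet the diagonal. *)
have defD : \matrix_(i < n + m, j < n) (d`_i *+ (i == j :> nat)) = col_mx D 0.
  apply/matrixP => i j; rewrite mxE; case: (split_ordP i) => k ->.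
    by rewrite col_mxEu mxE.
  by rewrite col_mxEd mxE /= gtn_eqF // ltn_addr.
(* The invertible [L] merely changes the coefficient vector, so the rows of [D *m U] generate the
   same subgroup. *)
have PB x : x \in P <-> exists y, x = y *m (D *m U).
  rewrite PA defM defD; split=> [[y ->] | [y ->]].
    exists (lsubmx (y *m L)).
    by rewrite !mulmxA -{1}[y *m L]hsubmxK mul_row_col mulmx0 addr0.
  exists (row_mx y 0 *m invmx L).
  by rewrite !mulmxA mulmxKV // mul_row_col mulmx0 addr0.
exists (D *m U) => //.
have rowX i : exists y : 'rV_n, row i q.+1%:Z%:M = y *m (D *m U).
  by apply/PB; rewrite -scalemx1 linearZ; exact: qP.
have [X defX] : exists X : 'M[int]_n, q.+1%:Z%:M = X *m (D *m U).
  have [f def_f] := fin_all_exists rowX.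
  by exists (\matrix_i f i); apply/row_matrixP => i; rewrite row_mul rowK -def_f.
(* Determinants turn the factorisation of [q.+1] times the identity into
   [q.+1 ^ n = \det X * \det (D *m U)], whose left side is nonzero. *)
have /eqP := congr1 determinant defX; rewrite det_scalar det_mulmx.
by apply: contraTneq => ->; rewrite mulr0 expf_neq0.
Qed.

Lemma scaled_row_span_lattice (R : realType) (n : nat) (s : R) (B : 'M[int]_n) :
    s != 0 -> \det B != 0 ->
  lattice [set s *: map_mx intr x | x in [set x | exists y, x = y *m B]]%classic.
Proof.
move=> s0 detB; pose BR : 'M[R]_n := s *: map_mx intr B.
have uB : BR \in unitmx.
  rewrite unitmxE unitfE detZ det_map_mx mulf_neq0 ?expf_neq0 //.
  by rewrite intr_eq0.
exists [tuple row i BR | i < n].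
  (* As there are [n] rows, spanning suffices; [v *m invmx BR] gives the coefficients of [v]. *)
  rewrite basisEdim size_tuple dimvf dim_matrix mul1r leqnn andbT.
  apply/subvP => v _; rewrite -(mulmxKV uB v) mulmx_sum_row rpred_sum // => i _.
  by rewrite memvZ // memv_span //; apply/tnthP; exists i; rewrite tnth_mktuple.
have combE (y : 'rV[int]_n) : s *: map_mx intr (y *m B) =
    \sum_(i < n) tnth [tuple row i BR | i < n] i *~ y 0 i.
  rewrite map_mxM scalemxAr mulmx_sum_row; apply: eq_bigr => i _.
  by rewrite tnth_mktuple mxE scaler_int.
apply/seteqP; split=> v.
  by case=> _ [y ->] <-; exists (y 0); rewrite combE.
case=> z ->; exists ((\row_i z i) *m B); first by exists (\row_i z i).
by rewrite combE; apply: eq_bigr => i _; rewrite mxE.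
Qed.

(** Translation by 1 permutes [R0], so the sum of all elements is unchanged when [#|R0|] is added to
    it. This puts [#|R0|] times any integer vector in the kernel of reduction. *)
Lemma natr_card_finRing (R0 : finComNzRingType) : #|R0|%:R = 0 :> R0.
Proof.
have : \sum_(x : R0) x = \sum_(x : R0) (x + 1) := reindex_inj (addIr 1).
by rewrite big_split sumr_const -[LHS]addr0 => /addrI.
Qed.

Section ConstructionA.

Variables (R : realType) (R0 : finComNzRingType) (n : nat).
Implicit Types (C : {set 'rV[R0]_n}) (G : {group 'S_n}).

Let scale : R := (Num.sqrt #|R0|%:R)^-1.

Let card_gt0 : (0 < #|R0|)%N.
Proof. by apply/card_gt0P; exists 0. Qed.

Let scale_neq0 : scale != 0.
Proof. by rewrite invr_eq0 lt0r_neq0 // sqrtr_gt0 ltr0n. Qed.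

Lemma construction_A_lattice C : linear_code C -> lattice (construction_A R C).
Proof.
move=> linC; have C0 := linC.1.
pose P : {pred 'rV[int]_n} := [pred x | reduction R0 x \in C].
have Pclosed : zmod_closed P.
  split=> [|x y]; rewrite !inE /reduction ?map_mx0 // map_mxB.
  exact: (GRing.submod_closedB linC).2.
pose PC : zmodClosed 'rV[int]_n :=
  HB.pack P (GRing.isZmodClosed.Build _ P Pclosed).
have [|B detB PB] := @subgroup_basis n #|R0|.-1 PC.
  move=> x; rewrite prednK // inE /reduction map_mxZ /= -pmulrn.
  by rewrite natr_card_finRing scale0r.
rewrite (_ : construction_A R C = [set scale *: map_mx intr x
    | x in [set x | exists y, x = y *m B]]%classic).
  exact: scaled_row_span_lattice.
by congr image; apply/seteqP; split=> x /PB.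
Qed.

(** The factor is nonzero and integers embed injectively in [R], so a point of the lattice has only
    one integer preimage. *)
Lemma mem_construction_A C (x : 'rV[int]_n) :
  construction_A R C (scale *: map_mx intr x) <-> reduction R0 x \in C.
Proof.
split=> [[y Cy /(scalerI scale_neq0) eq_yx] | Cx]; last by exists x.
suff <- : y = x by [].
by apply/matrixP => i j; have /matrixP/(_ i j) := eq_yx; rewrite !mxE => /intr_inj.
Qed.

Lemma G_code_construction_A G C :
    (forall a : R0, exists z : int, z%:~R = a) -> linear_code C ->
  G_code G C <-> G_lattice G (construction_A R C).
Proof.
move=> intr_surj linC.
have actE (g : 'S_n) (x : 'rV[int]_n) :
    coord_act (scale *: map_mx intr x) g = scale *: map_mx intr (coord_act x g).
  by apply/matrixP => i j; rewrite !mxE.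
have actR (g : 'S_n) (x : 'rV[int]_n) :
    coord_act (reduction R0 x) g = reduction R0 (coord_act x g).
  by rewrite /coord_act /reduction map_col_perm.
split=> [[_ GC] | [_ GL]]; split=> //.
- exact: construction_A_lattice.
- move=> g _ Gg [x Cx <-]; rewrite actE; apply/mem_construction_A.
  by rewrite -actR GC.
(* Surjectivity of [int] onto [R0] lifts the codeword [v] to an integer vector, where invariance of
   the lattice applies. *)
move=> g v Gg; have /fin_all_exists[z def_v] i := intr_surj (v 0 i).
have -> : v = reduction R0 (\row_i z i) by apply/rowP => i; rewrite !mxE.
rewrite actR => Cv; apply/mem_construction_A; rewrite -actE.
exact/GL/mem_construction_A.
Qed.

End ConstructionA.

Lemma intr_Zp_surj (k : nat) (a : 'Z_k) : exists z : int, z%:~R = a.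
Proof. by exists (a : nat)%:Z; rewrite -[RHS]natr_Zp. Qed.

Theorem theorem5p1 (R : realType) (n : nat) (G : {group 'S_n}) :
  (forall (k : nat) (hk : (1 < k)%N) (C : {set 'rV['Z_k]_n}),
     linear_code C -> (G_code G C <-> G_lattice G (construction_A R C))) /\
  (forall (p : nat) (hp : prime p) (C : {set 'rV['F_p]_n}),
     linear_code C -> (G_code G C <-> G_lattice G (construction_A R C))).
Proof.
(* ['F_p] unfolds to ['Z_(pdiv p)], so the same surjectivity serves both rings. *)
by split=> m _ C; apply: G_code_construction_A; exact: intr_Zp_surj.
Qed.
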